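(* Let $A$ and $B$ be diassociative algebras over a field $\mathbb{F}$. Suppose the factor system $(\varphi_{\dashv},\varphi_{\vdash},\varphi_{\dashv}',\varphi_{\vdash}',f_{\dashv},f_{\vdash})$ of $A$ by $B$ belongs to the extension $0\to A\xrightarrow{\sigma_1}L_1\xrightarrow{\pi_1}B\to0$ and section $T_1:B\to L_1$, and the factor system $(\psi_{\dashv},\psi_{\vdash},\psi_{\dashv}',\psi_{\vdash}',g_{\dashv},g_{\vdash})$ of $A$ by $B$ belongs to the extension $0\to A\xrightarrow{\sigma_2}L_2\xrightarrow{\pi_2}B\to0$ and section $T_2:B\to L_2$. Then the factor systems are equivalent if and only if the extensions are equivalent.
   Context: All algebras are vector spaces over a fixed field $\mathbb{F}$. A diassociative algebra is a vector space with two associative bilinear products $\dashv,\vdash$ satisfying, for all $x,y,z$: (D1) $x\dashv(y\dashv z)=x\dashv(y\vdash z)$; (D2) $(x\vdash y)\dashv z=x\vdash(y\dashv z)$; (D3) $(x\dashv y)\vdash z=(x\vdash y)\vdash z$. Homomorphisms are linear maps preserving both products. $\mathcal{L}(A)$ is the space of linear maps $A\to A$. A factor system of $A$ by $B$ is a tuple $(\varphi_{\dashv},\varphi_{\vdash},\varphi_{\dashv}',\varphi_{\vdash}',f_{\dashv},f_{\vdash})$ with $\varphi_{\dashv},\varphi_{\vdash},\varphi_{\dashv}',\varphi_{\vdash}':B\to\mathcal{L}(A)$ linear and $f_{\dashv},f_{\vdash}:B\times B\to A$ bilinear such that for all $m,n,p\in A$, $i,j,k\in B$: 1. (a) $m\dashv(\varphi_{\dashv}(j)p)=m\dashv(\varphi_{\vdash}(j)p)$;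 (b) $m\dashv(\varphi_{\dashv}'(k)n)=m\dashv(\varphi_{\vdash}'(k)n)$; (c) $m\dashv f_{\dashv}(j,k)+\varphi_{\dashv}'(j\dashv k)m=m\dashv f_{\vdash}(j,k)+\varphi_{\dashv}'(j\vdash k)m$; (d) $\varphi_{\dashv}(i)(n\dashv p)=\varphi_{\dashv}(i)(n\vdash p)$; (e) $\varphi_{\dashv}(i)(\varphi_{\dashv}(j)p)=\varphi_{\dashv}(i)(\varphi_{\vdash}(j)p)$; (f) $\varphi_{\dashv}(i)(\varphi_{\dashv}'(k)n)=\varphi_{\dashv}(i)(\varphi_{\vdash}'(k)n)$; (g) $\varphi_{\dashv}(i)f_{\dashv}(j,k)+f_{\dashv}(i,j\dashv k)=\varphi_{\dashv}(i)f_{\vdash}(j,k)+f_{\dashv}(i,j\vdash k)$. 2. (a) $(\varphi_{\vdash}(i)n)\dashv p=\varphi_{\vdash}(i)(n\dashv p)$; (b) $(\varphi_{\vdash}'(j)m)\dashv p=m\vdash(\varphi_{\dashv}(j)p)$; (c) $f_{\vdash}(i,j)\dashv p+\varphi_{\dashv}(i\vdash j)p=\varphi_{\vdash}(i)(\varphi_{\dashv}(j)p)$; (d) $\varphi_{\dashv}'(k)(m\vdash n)=m\vdash(\varphi_{\dashv}'(k)n)$; (e) $\varphi_{\dashv}'(k)(\varphi_{\vdash}(i)n)=\varphi_{\vdash}(i)(\varphi_{\dashv}'(k)n)$; (f) $\varphi_{\dashv}'(k)(\varphi_{\vdash}'(j)m)=\varphi_{\vdash}'(j\dashv k)m+m\vdash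 f_{\dashv}(j,k)$; (g) $\varphi_{\dashv}'(k)f_{\vdash}(i,j)+f_{\dashv}(i\vdash j,k)=\varphi_{\vdash}(i)f_{\dashv}(j,k)+f_{\vdash}(i,j\dashv k)$. 3. (a) $(\varphi_{\dashv}(i)n)\vdash p=(\varphi_{\vdash}(i)n)\vdash p$; (b) $(\varphi_{\dashv}'(j)m)\vdash p=(\varphi_{\vdash}'(j)m)\vdash p$; (c) $f_{\dashv}(i,j)\vdash p+\varphi_{\vdash}(i\dashv j)p=f_{\vdash}(i,j)\vdash p+\varphi_{\vdash}(i\vdash j)p$; (d) $\varphi_{\vdash}'(k)(m\dashv n)=\varphi_{\vdash}'(k)(m\vdash n)$; (e) $\varphi_{\vdash}'(k)(\varphi_{\dashv}(i)n)=\varphi_{\vdash}'(k)(\varphi_{\vdash}(i)n)$; (f) $\varphi_{\vdash}'(k)(\varphi_{\dashv}'(j)m)=\varphi_{\vdash}'(k)(\varphi_{\vdash}'(j)m)$; (g) $\varphi_{\vdash}'(k)f_{\dashv}(i,j)+f_{\vdash}(i\dashv j,k)=\varphi_{\vdash}'(k)f_{\vdash}(i,j)+f_{\vdash}(i\vdash j,k)$. 4. (a) $m\dashv(\varphi_{\dashv}(j)p)=(\varphi_{\dashv}'(j)m)\dashv p$; (b) $m\dashv(\varphi_{\dashv}'(k)n)=\varphi_{\dashv}'(k)(m\dashv n)$; (c) $m\dashv f_{\dashv}(j,k)+\varphi_{\dashv}'(j\dashv k)m=\varphi_{\dashv}'(k)(\varphi_{\dashv}'(j)m)$; (d) $\varphi_{\dashv}(i)(n\dashv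 p)=(\varphi_{\dashv}(i)n)\dashv p$; (e) $\varphi_{\dashv}(i)(\varphi_{\dashv}(j)p)=\varphi_{\dashv}(i\dashv j)p+f_{\dashv}(i,j)\dashv p$; (f) $\varphi_{\dashv}(i)(\varphi_{\dashv}'(k)n)=\varphi_{\dashv}'(k)(\varphi_{\dashv}(i)n)$; (g) $\varphi_{\dashv}(i)f_{\dashv}(j,k)+f_{\dashv}(i,j\dashv k)=\varphi_{\dashv}'(k)f_{\dashv}(i,j)+f_{\dashv}(i\dashv j,k)$. 5. The identities obtained from 4(a)–(g) by replacing every $\dashv$ (including in subscripts) by $\vdash$. An extension of $A$ by $B$ is a short exact sequence $0\to A\xrightarrow{\sigma}L\xrightarrow{\pi}B\to0$ with $L$ a diassociative algebra and $\sigma,\pi$ homomorphisms. A section is a linear map $T:B\to L$ with $\pi T=I_B$. For $x\in L$, $m\in A$ put $P_{\dashv}(x)m=\sigma^{-1}(x\dashv\sigma(m))$, $P_{\dashv}'(x)m=\sigma^{-1}(\sigma(m)\dashv x)$, $P_{\vdash}(x)m=\sigma^{-1}(x\vdash\sigma(m))$, $P_{\vdash}'(x)m=\sigma^{-1}(\sigma(m)\vdash x)$. A factor system belongs to the extension and $T$ if $\varphi_{\dashv}=P_{\dashv}T$, $\varphi_{\vdash}=P_{\vdash}T$, $\varphi_{\dashv}'=P_{\dashv}'T$, $\varphi_{\vdash}'=P_{\vdash}'T$, $\sigma(f_{\dashv}(i,j))=T(i)\dashv T(j)-T(i\dashv j)$ and $\sigma(f_{\vdash}(i,j))=T(i)\vdash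 T(j)-T(i\vdash j)$ for all $i,j\in B$. Two extensions as in the claim are equivalent if there is an isomorphism $\tau:L_1\to L_2$ with $\tau\sigma_1=\sigma_2$ and $\pi_2\tau=\pi_1$. Factor systems $(\varphi_{\dashv},\varphi_{\vdash},\varphi_{\dashv}',\varphi_{\vdash}',f_{\dashv},f_{\vdash})$ and $(\psi_{\dashv},\psi_{\vdash},\psi_{\dashv}',\psi_{\vdash}',g_{\dashv},g_{\vdash})$ are equivalent if there is a linear map $E:B\to A$ (an equivalence) such that for each $*\in\{\dashv,\vdash\}$ and all $i,j\in B$, $m\in A$: $\psi_*(i)m=\varphi_*(i)m+E(i)*m$; $\psi_*'(i)m=\varphi_*'(i)m+m*E(i)$; $g_*(i,j)=f_*(i,j)+\varphi_*'(j)E(i)+\varphi_*(i)E(j)+E(i)*E(j)-E(i*j)$. *)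

(* Defs.v *)
From HB Require Import structures.
From mathcomp Require Import all_boot all_algebra.

Set Implicit Arguments.
Unset Strict Implicit.
Unset Printing Implicit Defensive.

Import GRing.Theory.
Local Open Scope ring_scope.

Declare Scope diassoc_scope.
Delimit Scope diassoc_scope with D.
Open Scope diassoc_scope.

(* The two products, and the pairs of maps indexed by them, are families over
   this type, so that a clause "for each * in {⊣, ⊢}" is a quantification. *)
Inductive dop : Type := Dashv | Vdash.

HB.mixin Record Lmodule_isDiassociative (F : fieldType) V
    of GRing.Lmodule F V := {
  dprod : dop -> {bilinear V -> V -> V};
  dprodA : forall (o : dop) (x y z : V),
    dprod o x (dprod o y z) = dprod o (dprod o x y) z;
  dprodD1 : forall x y z : V,
    dprod Dashv x (dprod Dashv y z) = dprod Dashv x (dprod Vdash y z);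
  dprodD2 : forall x y z : V,
    dprod Dashv (dprod Vdash x y) z = dprod Vdash x (dprod Dashv y z);
  dprodD3 : forall x y z : V,
    dprod Vdash (dprod Dashv x y) z = dprod Vdash (dprod Vdash x y) z
}.

#[short(type="diassocType")]
HB.structure Definition Diassociative (F : fieldType) :=
  {V of GRing.Lmodule F V & Lmodule_isDiassociative F V}.

Notation "x ⊣ y" := (dprod Dashv x y)
  (at level 40, left associativity) : diassoc_scope.
Notation "x ⊢ y" := (dprod Vdash x y)
  (at level 40, left associativity) : diassoc_scope.

Definition dihom (F : fieldType) (A B : diassocType F) (h : A -> B) : Prop :=
  forall (o : dop) (x y : A), h (dprod o x y) = dprod o (h x) (h y).

(* [phi o], [phi' o] and [fac o] are φ_o, φ'_o and f_o.  A linear map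
   B -> L(A) is given uncurried, as a bilinear map B -> A -> A. *)
Record factor_system (F : fieldType) (A B : diassocType F) := FactorSystem {
  phi : dop -> {bilinear B -> A -> A};
  phi' : dop -> {bilinear B -> A -> A};
  fac : dop -> {bilinear B -> B -> A};

  fs1a : forall (m p : A) (j : B),
    m ⊣ phi Dashv j p = m ⊣ phi Vdash j p;
  fs1b : forall (m n : A) (k : B),
    m ⊣ phi' Dashv k n = m ⊣ phi' Vdash k n;
  fs1c : forall (m : A) (j k : B),
    m ⊣ fac Dashv j k + phi' Dashv (j ⊣ k) m
    = m ⊣ fac Vdash j k + phi' Dashv (j ⊢ k) m;
  fs1d : forall (n p : A) (i : B),
    phi Dashv i (n ⊣ p) = phi Dashv i (n ⊢ p);
  fs1e : forall (p : A) (i j : B),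
    phi Dashv i (phi Dashv j p) = phi Dashv i (phi Vdash j p);
  fs1f : forall (n : A) (i k : B),
    phi Dashv i (phi' Dashv k n) = phi Dashv i (phi' Vdash k n);
  fs1g : forall i j k : B,
    phi Dashv i (fac Dashv j k) + fac Dashv i (j ⊣ k)
    = phi Dashv i (fac Vdash j k) + fac Dashv i (j ⊢ k);

  fs2a : forall (n p : A) (i : B),
    phi Vdash i n ⊣ p = phi Vdash i (n ⊣ p);
  fs2b : forall (m p : A) (j : B),
    phi' Vdash j m ⊣ p = m ⊢ phi Dashv j p;
  fs2c : forall (p : A) (i j : B),
    fac Vdash i j ⊣ p + phi Dashv (i ⊢ j) p = phi Vdash i (phi Dashv j p);
  fs2d : forall (m n : A) (k : B),
    phi' Dashv k (m ⊢ n) = m ⊢ phi' Dashv k n;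
  fs2e : forall (n : A) (i k : B),
    phi' Dashv k (phi Vdash i n) = phi Vdash i (phi' Dashv k n);
  fs2f : forall (m : A) (j k : B),
    phi' Dashv k (phi' Vdash j m) = phi' Vdash (j ⊣ k) m + m ⊢ fac Dashv j k;
  fs2g : forall i j k : B,
    phi' Dashv k (fac Vdash i j) + fac Dashv (i ⊢ j) k
    = phi Vdash i (fac Dashv j k) + fac Vdash i (j ⊣ k);

  fs3a : forall (n p : A) (i : B),
    phi Dashv i n ⊢ p = phi Vdash i n ⊢ p;
  fs3b : forall (m p : A) (j : B),
    phi' Dashv j m ⊢ p = phi' Vdash j m ⊢ p;
  fs3c : forall (p : A) (i j : B),
    fac Dashv i j ⊢ p + phi Vdash (i ⊣ j) p
    = fac Vdash i j ⊢ p + phi Vdash (i ⊢ j) p;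
  fs3d : forall (m n : A) (k : B),
    phi' Vdash k (m ⊣ n) = phi' Vdash k (m ⊢ n);
  fs3e : forall (n : A) (i k : B),
    phi' Vdash k (phi Dashv i n) = phi' Vdash k (phi Vdash i n);
  fs3f : forall (m : A) (j k : B),
    phi' Vdash k (phi' Dashv j m) = phi' Vdash k (phi' Vdash j m);
  fs3g : forall i j k : B,
    phi' Vdash k (fac Dashv i j) + fac Vdash (i ⊣ j) k
    = phi' Vdash k (fac Vdash i j) + fac Vdash (i ⊢ j) k;

  fs4a : forall (o : dop) (m p : A) (j : B),
    dprod o m (phi o j p) = dprod o (phi' o j m) p;
  fs4b : forall (o : dop) (m n : A) (k : B),
    dprod o m (phi' o k n) = phi' o k (dprod o m n);
  fs4c : forall (o : dop) (m : A) (j k : B),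
    dprod o m (fac o j k) + phi' o (dprod o j k) m = phi' o k (phi' o j m);
  fs4d : forall (o : dop) (n p : A) (i : B),
    phi o i (dprod o n p) = dprod o (phi o i n) p;
  fs4e : forall (o : dop) (p : A) (i j : B),
    phi o i (phi o j p) = phi o (dprod o i j) p + dprod o (fac o i j) p;
  fs4f : forall (o : dop) (n : A) (i k : B),
    phi o i (phi' o k n) = phi' o k (phi o i n);
  fs4g : forall (o : dop) (i j k : B),
    phi o i (fac o j k) + fac o i (dprod o j k)
    = phi' o k (fac o i j) + fac o (dprod o i j) k
}.

Definition is_fs_equivalence (F : fieldType) (A B : diassocType F)
    (S S' : factor_system A B) (E : {linear B -> A}) : Prop :=
  forall o : dop,
  [/\ forall (i : B) (m : A), phi S' o i m = phi S o i m + dprod o (E i) m,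
      forall (i : B) (m : A), phi' S' o i m = phi' S o i m + dprod o m (E i)
    & forall i j : B,
        fac S' o i j = fac S o i j + phi' S o j (E i) + phi S o i (E j)
                       + dprod o (E i) (E j) - E (dprod o i j)].

Definition fs_equivalent (F : fieldType) (A B : diassocType F)
    (S S' : factor_system A B) : Prop :=
  exists E : {linear B -> A}, is_fs_equivalence S S' E.

Record extension (F : fieldType) (A B : diassocType F) := Extension {
  ext_alg :> diassocType F;
  ext_inj : {linear A -> ext_alg};
  ext_proj : {linear ext_alg -> B};
  ext_inj_hom : dihom ext_inj;
  ext_proj_hom : dihom ext_proj;
  ext_inj_injective : injective ext_inj;
  ext_proj_surjective : forall b : B, exists x : ext_alg, ext_proj x = b;
  ext_exact : forall x : ext_alg,
    (exists m : A, ext_inj m = x) <-> ext_proj x = 0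
}.

Definition ext_equivalent (F : fieldType) (A B : diassocType F)
    (X1 X2 : extension A B) : Prop :=
  exists tau : {linear X1 -> X2},
  [/\ dihom tau, bijective tau,
      forall m : A, tau (ext_inj X1 m) = ext_inj X2 m
    & forall x : X1, ext_proj X2 (tau x) = ext_proj X1 x].

Definition ext_section (F : fieldType) (A B : diassocType F)
    (X : extension A B) (T : {linear B -> X}) : Prop :=
  forall b : B, ext_proj X (T b) = b.

Section Operators.

Variables (F : fieldType) (A B : diassocType F) (X : extension A B).

Lemma ext_preimage (x : X) : ext_proj X x = 0 -> exists m, ext_inj X m == x.
Proof. by move/ext_exact=> [m <-]; exists m. Qed.

Lemma ext_proj_inj (m : A) : ext_proj X (ext_inj X m) = 0.
Proof. by apply/ext_exact; exists m. Qed.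

Lemma ext_proj_prodl (o : dop) (x : X) (m : A) :
  ext_proj X (dprod o x (ext_inj X m)) = 0.
Proof. by rewrite ext_proj_hom ext_proj_inj linear0r. Qed.

Lemma ext_proj_prodr (o : dop) (x : X) (m : A) :
  ext_proj X (dprod o (ext_inj X m) x) = 0.
Proof. by rewrite ext_proj_hom ext_proj_inj linear0l. Qed.

(* σ^-1, defined on Im σ = Ker π *)
Definition ext_inv (x : X) (px0 : ext_proj X x = 0) : A :=
  xchoose (ext_preimage px0).

Lemma ext_invK (x : X) (px0 : ext_proj X x = 0) :
  ext_inj X (ext_inv px0) = x.
Proof. exact/eqP/(xchooseP (ext_preimage px0)). Qed.

(* P_o(x) m = σ^-1(x o σ(m))  and  P'_o(x) m = σ^-1(σ(m) o x) *)
Definition ext_P (o : dop) (x : X) (m : A) : A :=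
  ext_inv (ext_proj_prodl o x m).

Definition ext_P' (o : dop) (x : X) (m : A) : A :=
  ext_inv (ext_proj_prodr o x m).

Definition fs_belongs (S : factor_system A B) (T : {linear B -> X}) : Prop :=
  forall o : dop,
  [/\ forall (i : B) (m : A), phi S o i m = ext_P o (T i) m,
      forall (i : B) (m : A), phi' S o i m = ext_P' o (T i) m
    & forall i j : B,
        ext_inj X (fac S o i j) = dprod o (T i) (T j) - T (dprod o i j)].

End Operators.

(* Main.v *)
Require Import Defs.
From HB Require Import structures.
From mathcomp Require Import all_boot all_algebra.

(** A section [T] identifies an extension [X] with [A + B] as a vector space:
    every [x] is [σ a + T b] for a unique [a : A] and [b = π x].  The factor
    system records exactly the products of the two kinds of summands, so it
    determines the multiplication of [X] in these coordinates.

    Two facts follow.  First, if sections of two extensions realize the same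
    factor system, sending [σ1 a + T1 b] to [σ2 a + T2 b] is an equivalence of
    extensions ([realizes_ext_equivalent]); conversely an equivalence [τ]
    carries a section realizing [S] to a section realizing [S]
    ([realizes_transport]).  Secondly, inside one extension, two sections differ
    by [σ E] for a linear [E : B -> A], and expanding the products of
    [T + σ E] yields precisely the formulas defining an equivalence of factor
    systems ([realizes_shift]).

    Hence, given an equivalence [E] from [S1] to [S2], the map [- E] is an
    equivalence from [S2] to [S1], and the section [T2 - σ2 E] of [X2] realizes
    [S1], as [T1] does in [X1]; so the extensions are equivalent.  Given [τ],
    both [τ T1] (realizing [S1]) and [T2] (realizing [S2]) are sections of
    [X2], so their difference is an equivalence of factor systems. *)

Set Implicit Arguments.
Unset Strict Implicit.
Unset Printing Implicit Defensive.

Import GRing.Theory.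
Local Open Scope ring_scope.

(** The condition [fs_belongs] with [σ^-1] cleared, which makes it a set of
    equations in [X] that can be expanded by linearity. *)
Definition realizes (F : fieldType) (A B : diassocType F) (X : extension A B)
    (S : factor_system A B) (T : {linear B -> X}) : Prop :=
  forall o : dop,
  [/\ forall (i : B) (m : A),
        dprod o (T i) (ext_inj X m) = ext_inj X (phi S o i m),
      forall (i : B) (m : A),
        dprod o (ext_inj X m) (T i) = ext_inj X (phi' S o i m)
    & forall i j : B,
        dprod o (T i) (T j) = ext_inj X (fac S o i j) + T (dprod o i j)].

Lemma fs_belongs_realizes (F : fieldType) (A B : diassocType F)
    (X : extension A B) (S : factor_system A B) (T : {linear B -> X}) :
  fs_belongs S T -> realizes S T.
Proof.
move=> hS o; have [h h' hf] := hS o; split=> [i m|i m|i j].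
- by rewrite h ext_invK.
- by rewrite h' ext_invK.
- by rewrite hf subrK.
Qed.

Section Coordinates.

Variables (F : fieldType) (A B : diassocType F) (X : extension A B).
Variables (T : {linear B -> X}) (hT : ext_section T).

Lemma section_residue (x : X) : ext_proj X (x - T (ext_proj X x)) = 0.
Proof. by rewrite linearB /= hT subrr. Qed.

(** The projection of [X] onto [A] along the image of [T]. *)
Definition section_coord (x : X) : A := ext_inv (section_residue x).

Lemma section_coordK (x : X) :
  ext_inj X (section_coord x) + T (ext_proj X x) = x.
Proof. by rewrite ext_invK subrK. Qed.

Lemma section_coordE (a : A) (b : B) :
  section_coord (ext_inj X a + T b) = a.
Proof.
apply: (@ext_inj_injective _ _ _ X); rewrite ext_invK.
by rewrite linearD /= ext_proj_inj hT add0r addrK.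
Qed.

Lemma section_coord_is_linear : linear section_coord.
Proof.
move=> c x y; apply: (@ext_inj_injective _ _ _ X).
rewrite [RHS]linearP !ext_invK (linearP (ext_proj X)) (linearP T) /= scalerBr.
by rewrite opprD addrACA.
Qed.

HB.instance Definition _ :=
  GRing.isLinear.Build F X A _ section_coord section_coord_is_linear.

End Coordinates.

Section Product.

Variables (F : fieldType) (A B : diassocType F) (X : extension A B).
Variables (S : factor_system A B) (T : {linear B -> X}).

(** In the coordinates given by [T] the multiplication involves only [S], which
    is why extensions realizing the same [S] are indistinguishable. *)
Lemma realizes_prod (hS : realizes S T) (o : dop) (a b : A) (i j : B) :
  dprod o (ext_inj X a + T i) (ext_inj X b + T j)
  = ext_inj X (fac S o i j + phi' S o j a + phi S o i b + dprod o a b)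
    + T (dprod o i j).
Proof.
have [h h' hf] := hS o.
rewrite linearDl /= !linearDr /= h h' hf -ext_inj_hom !linearD /=.
by rewrite !addrA; congr (_ + _); rewrite (ACl (4*2*3*1)).
Qed.

(** The change of section formula.  Expanding the products of [T + σ E] gives
    the formulas of [is_fs_equivalence] under [σ], which is injective. *)
Lemma realizes_shift (S' : factor_system A B) (T' : {linear B -> X})
    (E : {linear B -> A}) :
    (forall i, T' i = T i + ext_inj X (E i)) -> realizes S T ->
  realizes S' T' <-> is_fs_equivalence S S' E.
Proof.
move=> T'E hS.
have prodl o i m : dprod o (T' i) (ext_inj X m)
    = ext_inj X (phi S o i m + dprod o (E i) m).
  have [h _ _] := hS o.
  by rewrite T'E linearDl /= h -ext_inj_hom linearD.
have prodr o i m : dprod o (ext_inj X m) (T' i)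
    = ext_inj X (phi' S o i m + dprod o m (E i)).
  have [_ h' _] := hS o.
  by rewrite T'E linearDr /= h' -ext_inj_hom linearD.
have prodT o i j : dprod o (T' i) (T' j)
    = ext_inj X (fac S o i j + phi' S o j (E i) + phi S o i (E j)
                 + dprod o (E i) (E j) - E (dprod o i j)) + T' (dprod o i j).
  rewrite !T'E ![T _ + _]addrC (realizes_prod hS) addrA -linearD /=.
  by rewrite subrK.
have sigmaI := @ext_inj_injective _ _ _ X.
split=> hS' o; have [h h' hf] := hS' o; split=> [i m|i m|i j].
- by apply: sigmaI; rewrite -h prodl.
- by apply: sigmaI; rewrite -h' prodr.
- by apply: sigmaI; apply: (addIr (T' (dprod o i j))); rewrite -hf prodT.
- by rewrite h prodl.
- by rewrite h' prodr.
- by rewrite hf prodT.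
Qed.

End Product.

(** Undoing the shift: the operators of [S'] already contain [E], so the two
    terms quadratic in [E] that they contribute to [fac S] cancel against
    [E(i) * E(j)] and [(- E(i)) * (- E(j))]. *)
Lemma is_fs_equivalence_sym (F : fieldType) (A B : diassocType F)
    (S S' : factor_system A B) (E : {linear B -> A}) :
  is_fs_equivalence S S' E -> is_fs_equivalence S' S (\- E).
Proof.
move=> hE o; have [h h' hf] := hE o; split=> [i m|i m|i j] /=.
- by rewrite h linearNl addrK.
- by rewrite h' linearNr addrK.
- rewrite hf !linearNr h h' !linearNl /= !opprK !opprD !addrA subrK.
  (* bring each summand next to its opposite *)
  by rewrite (ACl (1*2*6*3*8*4*7*9*5)) /= !addrK.
Qed.

Section Transport.

Variables (F : fieldType) (A B : diassocType F) (X1 X2 : extension A B).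

Lemma realizes_transport (S : factor_system A B) (T : {linear B -> X1})
    (tau : {linear X1 -> X2}) :
    dihom tau -> (forall m, tau (ext_inj X1 m) = ext_inj X2 m) ->
  realizes S T -> realizes S (tau \o T).
Proof.
move=> tauM tau_inj hS o; have [h h' hf] := hS o; split=> [i m|i m|i j] /=.
- by rewrite -!tau_inj -tauM h.
- by rewrite -!tau_inj -tauM h'.
- by rewrite -!tau_inj -tauM hf linearD.
Qed.

End Transport.

(** Built from linear maps, so that linearity is inherited; [section_matchE]
    gives the intended description, sending [σ1 a + T1 b] to [σ2 a + T2 b]. *)
Definition section_match (F : fieldType) (A B : diassocType F)
    (X1 X2 : extension A B) (T1 : {linear B -> X1}) (hT1 : ext_section T1)
    (T2 : {linear B -> X2}) : X1 -> X2 :=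
  (ext_inj X2 \o section_coord hT1) \+ (T2 \o ext_proj X1).

Lemma section_matchE (F : fieldType) (A B : diassocType F)
    (X1 X2 : extension A B) (T1 : {linear B -> X1}) (hT1 : ext_section T1)
    (T2 : {linear B -> X2}) (a : A) (b : B) :
  section_match hT1 T2 (ext_inj X1 a + T1 b) = ext_inj X2 a + T2 b.
Proof.
by rewrite /section_match /= section_coordE linearD /= ext_proj_inj hT1 add0r.
Qed.

Lemma section_matchK (F : fieldType) (A B : diassocType F)
    (X1 X2 : extension A B) (T1 : {linear B -> X1}) (hT1 : ext_section T1)
    (T2 : {linear B -> X2}) (hT2 : ext_section T2) :
  cancel (section_match hT1 T2) (section_match hT2 T1).
Proof.
by move=> x; rewrite -(section_coordK hT1 x) !section_matchE.
Qed.

HB.instance Definition _ (F : fieldType) (A B : diassocType F)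
    (X1 X2 : extension A B) (T1 : {linear B -> X1}) (hT1 : ext_section T1)
    (T2 : {linear B -> X2}) :=
  GRing.Linear.on (section_match hT1 T2).

(** The map matching coordinates preserves products because [realizes_prod] is
    the same formula on both sides; exchanging the sections gives its inverse. *)
Lemma realizes_ext_equivalent (F : fieldType) (A B : diassocType F)
    (X1 X2 : extension A B) (S : factor_system A B)
    (T1 : {linear B -> X1}) (T2 : {linear B -> X2}) :
    ext_section T1 -> ext_section T2 -> realizes S T1 -> realizes S T2 ->
  ext_equivalent X1 X2.
Proof.
move=> hT1 hT2 hS1 hS2; exists (section_match hT1 T2); split=> [o x y||m|x] /=.
- rewrite -(section_coordK hT1 x) -(section_coordK hT1 y).
  by rewrite (realizes_prod hS1) !section_matchE (realizes_prod hS2).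
- by exists (section_match hT2 T1); apply: section_matchK.
- rewrite -[ext_inj X1 m]addr0 -(linear0 T1) section_matchE.
  by rewrite linear0 addr0.
- by rewrite /section_match /= linearD /= ext_proj_inj hT2 add0r.
Qed.

Theorem theorem4p3 (F : fieldType) (A B : diassocType F)
    (S1 S2 : factor_system A B) (X1 X2 : extension A B)
    (T1 : {linear B -> X1}) (T2 : {linear B -> X2})
    (hT1 : ext_section T1) (hT2 : ext_section T2)
    (hS1 : fs_belongs S1 T1) (hS2 : fs_belongs S2 T2) :
  fs_equivalent S1 S2 <-> ext_equivalent X1 X2.
Proof.
have rS1 := fs_belongs_realizes hS1; have rS2 := fs_belongs_realizes hS2.
split=> [[E hE]|[tau [tauM _ tau_inj tau_proj]]].
- pose T : {linear B -> X2} := T2 \- (ext_inj X2 \o E).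
  have hT : ext_section T.
    by move=> b; rewrite /T /= linearB /= ext_proj_inj hT2 subr0.
  apply: (realizes_ext_equivalent hT1 hT rS1).
  pose E' : {linear B -> A} := \- E.
  have TE i : T i = T2 i + ext_inj X2 (E' i) by rewrite /T /= linearN.
  exact/(realizes_shift _ TE rS2)/is_fs_equivalence_sym.
- pose T : {linear B -> X2} := tau \o T1.
  have hT : ext_section T by move=> b; rewrite /T /= tau_proj hT1.
  pose E : {linear B -> A} := section_coord hT \o T2; exists E.
  have T2E i : T2 i = T i + ext_inj X2 (E i).
    by rewrite addrC -{1}(section_coordK hT (T2 i)) hT2.
  exact/(realizes_shift _ T2E (realizes_transport tauM tau_inj rS1)).
Qed.
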